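(* $\mathcal{MC} \cap \mathcal{ID} = \mathcal{I}_{1,0} \cap \mathcal{C}$.
   Context: An implicator groupoid is an algebra $\mathbf A = \langle A, \to, 0 \rangle$, with $\to$ binary and $0$ a constant, which, writing $x' := x \to 0$, satisfies the identities (I) $(x \to y) \to z \approx [(z' \to x) \to (y \to z)']'$ and (I$_0$) $0'' \approx 0$. Put $x \land y := (x \to y')'$. $\mathcal{MC}$, $\mathcal{ID}$, $\mathcal{I}_{1,0}$, $\mathcal{C}$ are the varieties of implicator groupoids satisfying, respectively, $x \land y \approx y \land x$; $x \to x \approx x$; $x' \approx x$; $x \to y \approx y \to x$. *)

(* Defs.v *)
From mathcomp Require Import all_boot.
From mathcomp Require Import classical_sets.

Set Implicit Arguments.
Unset Strict Implicit.
Unset Printing Implicit Defensive.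

Local Open Scope classical_set_scope.

(* Algebras of type (2, 0); no identity is imposed at this stage. *)
Record algebra20 := Algebra20 {
  carrier :> Type;
  imp : carrier -> carrier -> carrier;
  zero : carrier
}.

Arguments zero {a}.

Declare Scope implicator_scope.
Delimit Scope implicator_scope with imp.
Local Open Scope implicator_scope.

Notation "x ⇒ y" := (imp x y) (at level 55, right associativity)
  : implicator_scope.

(* The derived operation x'. *)
Definition neg (A : algebra20) (x : A) : A := x ⇒ zero.

Notation "¬ x" := (neg x) (at level 35, right associativity)
  : implicator_scope.

Definition meet (A : algebra20) (x y : A) : A := ¬ (x ⇒ ¬ y).

Notation "x ⊓ y" := (meet x y) (at level 40, left associativity)
  : implicator_scope.

Definition identity_I (A : algebra20) : Prop :=
  forall x y z : A, (x ⇒ y) ⇒ z = ¬ ((¬ z ⇒ x) ⇒ ¬ (y ⇒ z)).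

Definition identity_I0 (A : algebra20) : Prop :=
  ¬ ¬ (zero : A) = zero.

Definition implicator_groupoid : set algebra20 :=
  [set A | identity_I A /\ identity_I0 A].

Definition MC : set algebra20 :=
  [set A | implicator_groupoid A /\ forall x y : A, x ⊓ y = y ⊓ x].

Definition ID : set algebra20 :=
  [set A | implicator_groupoid A /\ forall x : A, x ⇒ x = x].

Definition I10 : set algebra20 :=
  [set A | implicator_groupoid A /\ forall x : A, ¬ x = x].

Definition C : set algebra20 :=
  [set A | implicator_groupoid A /\ forall x y : A, x ⇒ y = y ⇒ x].

(* Main.v *)
Require Import Defs.
From mathcomp Require Import all_boot.
From mathcomp Require Import classical_sets.

Set Implicit Arguments.
Unset Strict Implicit.

(** Both inclusions hinge on controlling the negation [x'].

    In a meet-commutative, idempotent implicator groupoid, [0 = 0 → 0 = 0'],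
    so commuting the meet of [x] with [0] gives [(0 → x')' = x''].  Comparing
    this with two instances of (I) in which the third variable is [0] yields
    [x'''' = x''].  By idempotence and (I), [x = (x → x) → x] is a negation,
    hence every element is a double negation, and [x'' = x] follows.  Finally
    idempotence turns [x ⊓ x' = (x → x'')'] into [(x → x)' = x'] and
    [x' ⊓ x = (x' → x')'] into [x'' = x]; commutativity of [⊓] identifies the
    two.  Once [x' = x], the meet is [→] itself, which is therefore
    commutative.

    Conversely, when [x' = x] the meet is again [→], so [→] and [⊓] commute
    together; and (I) at [(0, 0, z)] reads [0 → z = z → (0 → z)], where
    [0 → z = z → 0 = z], which is idempotence. *)

Local Open Scope classical_set_scope.
Local Open Scope implicator_scope.

Lemma neg_zero_of_idem (A : algebra20) :
  (forall x : A, x ⇒ x = x) -> ¬ (Defs.zero : A) = Defs.zero.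
Proof. by move=> idA; apply: idA. Qed.

(** By idempotence [x = (x → x) → x], and (I) writes any term of the shape
    [(a → b) → c] as a negation. *)
Lemma is_neg_of_idem (A : algebra20) :
  identity_I A -> (forall x : A, x ⇒ x = x) ->
  forall x : A, exists u : A, x = ¬ u.
Proof.
move=> IA idA x; exists ((¬ x ⇒ x) ⇒ ¬ (x ⇒ x)).
by rewrite -IA !idA.
Qed.

(** [(0 → x)''] is computed in two ways: (I) at [(x, 0, 0)] gives [x''],
    whereas (I) at [(0, x, 0)] gives [(0 → x)' = (0 → x'')'], which is
    [0 ⊓ x' = x' ⊓ 0 = x''']. *)
Lemma neg4_eq_neg2 (A : algebra20) :
  identity_I A -> (forall x y : A, x ⊓ y = y ⊓ x) -> ¬ (Defs.zero : A) = Defs.zero ->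
  forall x : A, ¬ ¬ ¬ ¬ x = ¬ ¬ x.
Proof.
move=> IA comA zA x.
have imp00 : Defs.zero ⇒ Defs.zero = Defs.zero :> A by [].
have neg_imp0 (y : A) : ¬ (Defs.zero ⇒ ¬ y) = ¬ ¬ y.
  by have := comA Defs.zero y; rewrite /meet zA.
have imp0_neg3 : ¬ (Defs.zero ⇒ x) = ¬ ¬ ¬ x.
  by have := IA Defs.zero x Defs.zero; rewrite zA imp00 -!/(neg _) neg_imp0.
have imp0_neg2 : ¬ ¬ (Defs.zero ⇒ x) = ¬ ¬ x.
  by have := IA x Defs.zero Defs.zero; rewrite zA imp00 zA.
by rewrite -imp0_neg3 imp0_neg2.
Qed.

Lemma neg_involutive_of_MC_ID (A : algebra20) :
  identity_I A -> (forall x y : A, x ⊓ y = y ⊓ x) ->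
  (forall x : A, x ⇒ x = x) -> forall x : A, ¬ ¬ x = x.
Proof.
move=> IA comA idA x.
have [u ->] := is_neg_of_idem IA idA x.
have [v ->] := is_neg_of_idem IA idA u.
exact: neg4_eq_neg2 IA comA (neg_zero_of_idem idA) v.
Qed.

Lemma neg_id_of_MC_ID (A : algebra20) :
  identity_I A -> (forall x y : A, x ⊓ y = y ⊓ x) ->
  (forall x : A, x ⇒ x = x) -> forall x : A, ¬ x = x.
Proof.
move=> IA comA idA x.
have negK := neg_involutive_of_MC_ID IA comA idA.
by have := comA x (¬ x); rewrite /meet negK !idA negK.
Qed.

Lemma meet_eq_imp (A : algebra20) :
  (forall x : A, ¬ x = x) -> forall x y : A, x ⊓ y = x ⇒ y.
Proof. by move=> negA x y; rewrite /meet !negA. Qed.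

(** Commutativity makes [0] a two-sided unit for [→], so (I) at [(0, 0, x)]
    collapses to idempotence. *)
Lemma idem_of_I10_C (A : algebra20) :
  identity_I A -> (forall x : A, ¬ x = x) ->
  (forall x y : A, x ⇒ y = y ⇒ x) -> forall x : A, x ⇒ x = x.
Proof.
move=> IA negA comA x.
have imp0r (y : A) : y ⇒ Defs.zero = y by exact: negA.
have imp0l (y : A) : Defs.zero ⇒ y = y by rewrite comA.
by have := IA Defs.zero Defs.zero x; rewrite !negA !imp0l !imp0r.
Qed.

Local Close Scope implicator_scope.

Theorem theorem12p2 : MC `&` ID = I10 `&` C.
Proof.
rewrite eqEsubset; split=> A [[gA hA] [_ kA]]; have [IA _] := gA.
- have negA := neg_id_of_MC_ID IA hA kA.
  by split; split=> // x y; rewrite -!(meet_eq_imp negA).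
- split; split=> //; last exact: idem_of_I10_C.
  by move=> x y; rewrite !(meet_eq_imp hA).
Qed.
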